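(* Let $N\ge 4$ and let $$V(\theta)=-\sum_{1\le i<j\le N}\left(\cos(\theta_i-\theta_j)+\frac12\log\bigl(2-2\cos(\theta_i-\theta_j)\bigr)\right).$$ Then the Hessian matrix of $V$ evaluated at the $N$-gon has at least one positive eigenvalue and one negative eigenvalue.
   Context: $V$ is defined for $\theta=(\theta_1,\dots,\theta_N)\in\mathbb{R}^N$ with $\theta_i\not\equiv\theta_j\pmod{2\pi}$ for $i\neq j$. The $N$-gon is the configuration of equally spaced angles, $\theta_j=\frac{2\pi(j-1)}{N}$, $j=1,\dots,N$ (up to rotation and permutation of indices). *)

(* Defs.v *)
From HB Require Import structures.
From mathcomp Require Import all_boot all_order all_algebra all_fingroup.
From mathcomp Require Import all_classical all_reals all_analysis.
Import Order.TTheory GRing.Theory Num.Theory.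
Import numFieldNormedType.Exports.

Set Implicit Arguments.
Unset Strict Implicit.
Unset Printing Implicit Defensive.

Local Open Scope ring_scope.

(* [ln 0 = 0] makes this a total function; it is the intended potential exactly
   where the angles [theta 0 i] are pairwise distinct modulo [2 pi], an open
   set which contains every N-gon. *)
Definition V (R : realType) (N : nat) (theta : 'rV[R]_N) : R :=
  - \sum_(i < N) \sum_(j < N | (i < j)%N)
      (cos (theta 0 i - theta 0 j)
       + 2^-1 * ln (2 - 2 * cos (theta 0 i - theta 0 j))).

(* Indices run over 0, ..., N-1, so the standard N-gon (the case [c = 0],
   [s = 1]) has [theta 0 j = 2 pi j / N]; [c] is a rotation and [s] a
   relabelling of the points. *)
Definition is_Ngon (R : realType) (N : nat) (theta : 'rV[R]_N) : Prop :=
  exists (c : R) (s : 'S_N),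
    forall j : 'I_N, theta 0 j = c + 2 * pi * (s j)%:R / N%:R.

Definition Hessian (R : realType) (N : nat) (f : 'rV[R]_N -> R)
    (x : 'rV[R]_N) : 'M[R]_N :=
  \matrix_(i, j) 'D_(delta_mx 0 i) ('D_(delta_mx 0 j) f) x.

(* Main.v *)
Require Import Defs.
From HB Require Import structures.
From mathcomp Require Import all_boot all_order all_algebra all_fingroup.
From mathcomp Require Import all_classical all_reals all_analysis.
From mathcomp Require Import ring lra.
Import Order.TTheory GRing.Theory Num.Theory.
Import numFieldNormedType.Exports.
Local Open Scope ring_scope.

(** Write [V = - sum_(k < l) g (theta_k - theta_l)], where
    [g z = cos z + ln (2 - 2 cos z) / 2]. Off the collision set,
    [g'' = - h] with [h z = cos z + 1 / (2 - 2 cos z)] even, and the Hessian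
    [H] of such a pair potential acts by
      [(v H)_j = sum_l h (theta_j - theta_l) (v_j - v_l)]
    ([mul_Hessian_pair_sum]): it is a weighted graph Laplacian.

    At the [N]-gon this Laplacian commutes with the rotation of the indices, so
    the Fourier mode [v_j = cos (k phi_j)], with [phi_j] the angle of the
    [j]-th point, is an eigenvector: expanding [cos (k (phi_j - d))], the cosine
    part gives [v_j] times
      [lambda_k = sum_m h (2 pi m / N) (1 - cos (2 pi k m / N))]
    and the sine part vanishes because [h z * sin (k z)] is odd
    ([eigenvalue_Hessian_Ngon]).

    Two modes suffice. For [k = 1] and [k = 2] the factor [1 - cos (k z)] is
    divisible by [1 - cos z], which cancels the singular part of [h]: every
    term of [lambda_k] with [m <> 0] is a trigonometric polynomial of degree at
    most 3, and the sums of [cos (2 pi p m / N)] vanish for [p = 1, 2, 3]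
    because [N >= 4]. Only the constant terms and the correction at [m = 0]
    survive, giving [lambda_1 = - 1/2 < 0] and [lambda_2 = N - 2 > 0]. *)

(** * Hessian of a pair potential *)

(** The directional derivative only sees the restriction to a line; this reduces
    all the differentiation below to functions of one real variable. *)
Lemma is_derive_line (R : realType) (W : normedModType R) (f : W -> R)
    (x v : W) (df : R) :
  is_derive (0 : R) 1 (fun t => f (t *: v + x)) df -> is_derive x v f df.
Proof.
move=> [fxv <-]; apply: DeriveDef; first exact/derivable1P.
rewrite /derive; set q2 := fun h => h^-1 *: _; set q1 := fun h => h^-1 *: _.
suff -> : q2 = q1 by [].
by apply/funext => h; rewrite /q1 /q2 /= addr0 scale0r add0r [h *: 1]mulr1.
Qed.

Lemma is_derive_coord_diff (R : realType) (N : nat) (g : R -> R) (dg : R)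
    (x e : 'rV[R]_N) (k l : 'I_N) :
  is_derive (x 0 k - x 0 l) 1 g dg ->
  is_derive x e (fun y => g (y 0 k - y 0 l)) (dg * (e 0 k - e 0 l)).
Proof.
move=> Dg; apply: is_derive_line.
pose w := e 0 k - e 0 l; pose d := x 0 k - x 0 l.
have -> : (fun t : R => g ((t *: e + x) 0 k - (t *: e + x) 0 l)) =
    g \o (fun t : R => t * w + d).
  by apply/funext => t /=; rewrite !mxE /w /d; congr (g _); ring.
apply: is_derive1_comp; first by rewrite mul0r add0r.
apply: is_derive_eq.
by rewrite /GRing.scale /= mulr0 !addr0 add0r mulr1.
Qed.

(** The weights [w] make the class of pair sums stable under directional
    derivatives, so that one differentiation lemma serves twice. *)
Definition pair_sum (R : realType) (N : nat) (g : R -> R) (w : 'I_N -> 'I_N -> R)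
    (y : 'rV[R]_N) : R :=
  \sum_(k < N) \sum_(l < N | (k < l)%N) g (y 0 k - y 0 l) * w k l.

Arguments pair_sum {R N} g%_function_scope w%_function_scope y.

Lemma is_derive_bigsum (R : realType) (W : normedModType R) (I : Type)
    (r : seq I) (P : pred I) (h : I -> W -> R) (dh : I -> R) (x v : W) :
  (forall i, P i -> is_derive x v (h i) (dh i)) ->
  is_derive x v (fun y => \sum_(i <- r | P i) h i y) (\sum_(i <- r | P i) dh i).
Proof.
move=> Dh.
have -> : (fun y => \sum_(i <- r | P i) h i y) = \sum_(i <- r | P i) h i.
  by apply/funext => y; rewrite fct_sumE.
elim/big_ind2 : _ => //; first exact: is_derive_cst.
by move=> ? ? ? ? ? ?; exact: is_deriveD.
Qed.

Lemma is_derive_pair_sum (R : realType) (N : nat) (g g' : R -> R)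
    (w : 'I_N -> 'I_N -> R) (x e : 'rV[R]_N) :
  (forall k l : 'I_N, (k < l)%N ->
     is_derive (x 0 k - x 0 l) 1 g (g' (x 0 k - x 0 l))) ->
  is_derive x e (pair_sum g w)
    (pair_sum g' (fun k l => w k l * (e 0 k - e 0 l)) x).
Proof.
move=> Dg; apply: is_derive_bigsum => k _; apply: is_derive_bigsum => l kl.
rewrite (_ : (fun y => _) = w k l *: (fun y : 'rV[R]_N => g (y 0 k - y 0 l))); last first.
  by apply/funext => y; rewrite mulrC.
apply: is_derive_eq.
  by apply: is_deriveZ; apply: is_derive_coord_diff; exact: Dg.
by rewrite /GRing.scale /=; ring.
Qed.

(** [g] has to be differentiable at all points near [x], not just at [x], since
    the inner derivative must be identified on a neighbourhood of [x] before it
    can be differentiated. *)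
Lemma Hessian_pair_sum (R : realType) (N : nat) (U : 'rV[R]_N -> R)
    (g g' g'' : R -> R) (x : 'rV[R]_N) :
  (forall y, U y = - pair_sum g (fun _ _ => 1) y) ->
  (\forall y \near x, forall k l : 'I_N, (k < l)%N ->
     let d := (y : 'rV[R]_N) 0 k - y 0 l in is_derive d 1 g (g' d)) ->
  (forall k l : 'I_N, (k < l)%N ->
     is_derive (x 0 k - x 0 l) 1 g' (g'' (x 0 k - x 0 l))) ->
  forall i j, Hessian U x i j =
    - pair_sum g'' (fun k l => ((k == j)%:R - (l == j)%:R) *
                                   ((k == i)%:R - (l == i)%:R)) x.
Proof.
move=> Ue Dg Dg' i j; rewrite mxE.
have deltaE (a k : 'I_N) : (delta_mx 0 a : 'rV[R]_N) 0 k = (k == a)%:R.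
  by rewrite mxE.
rewrite (@near_eq_derive _ _ _ _
   (- pair_sum g' (fun k l => (k == j)%:R - (l == j)%:R))); last first.
  near=> y.
  rewrite (_ : U = - pair_sum g (fun _ _ => 1)); last exact/funext.
  apply: derive_val; apply: is_deriveN.
  apply: is_derive_eq.
    by apply: (is_derive_pair_sum _ _ _ g'); near: y; exact: Dg.
  by apply: eq_bigr => k _; apply: eq_bigr => l _; rewrite mul1r !deltaE.
apply: derive_val; apply: is_deriveN; apply: is_derive_eq.
  exact: (is_derive_pair_sum _ _ _ g'').
by apply: eq_bigr => k _; apply: eq_bigr => l _; rewrite !deltaE.
Unshelve. all: by end_near.
Qed.

Lemma sum_mul_delta (R : pzRingType) (I : finType) (F : I -> R) (k : I) :
  \sum_i F i * (i == k)%:R = F k.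
Proof.
rewrite (bigD1 k) //= eqxx mulr1 big1 ?addr0 // => i /negPf ->.
by rewrite mulr0.
Qed.

(** Each pair [{j, l}] is listed once, in increasing order; antisymmetry turns
    the sign picked up by the pairs with [l < j] back into [A j l]. *)
Lemma antisym_pair_sum (R : pzRingType) (N : nat) (A : 'I_N -> 'I_N -> R)
    (j : 'I_N) :
  (forall k l, A l k = - A k l) -> A j j = 0 ->
  \sum_(k < N) \sum_(l < N | (k < l)%N)
     A k l * ((k == j)%:R - (l == j)%:R) = \sum_(l < N) A j l.
Proof.
move=> antiA Ajj.
transitivity (\sum_(l < N) (if (j < l)%N then A j l else 0)
              - \sum_(k < N) (if (k < j)%N then A k j else 0)).
  rewrite -[X in X - _]big_mkcond /=.
  rewrite -(sum_mul_delta _ _ (fun k : 'I_N => \sum_(l < N | (k < l)%N) A k l)) -sumrB.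
  apply: eq_bigr => k _; rewrite mulr_suml.
  rewrite -(sum_mul_delta _ _ (fun l : 'I_N => if (k < l)%N then A k l else 0)).
  rewrite big_mkcond [X in _ = X - _]big_mkcond /= -sumrB.
  by apply: eq_bigr => l _; case: ifP => _; rewrite ?mulrBr ?mul0r ?subr0.
rewrite -sumrB; apply: eq_bigr => l _.
by case: ltngtP => [||/val_inj <-]; rewrite ?subr0 ?sub0r ?Ajj //.
Qed.

(** Evenness of [g''] makes each summand antisymmetric in its two indices, which
    removes the order restriction on the pairs. *)
Lemma mul_Hessian_pair_sum (R : realType) (N : nat) (H : 'M[R]_N)
    (g'' : R -> R) (x v : 'rV[R]_N) (j : 'I_N) :
  (forall z, g'' (- z) = g'' z) ->
  (forall i j, H i j =
    - pair_sum g'' (fun k l => ((k == j)%:R - (l == j)%:R) *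
                                   ((k == i)%:R - (l == i)%:R)) x) ->
  (v *m H) 0 j = - \sum_(l < N) g'' (x 0 j - x 0 l) * (v 0 j - v 0 l).
Proof.
move=> even_g'' HE.
rewrite -(@antisym_pair_sum _ _ (fun k l => g'' (x 0 k - x 0 l) * (v 0 k - v 0 l))).
- rewrite mxE.
  under eq_bigr => i _ do rewrite HE mulrN /pair_sum mulr_sumr.
  rewrite sumrN; congr (- _); rewrite exchange_big /=; apply: eq_bigr => k _.
  under eq_bigr => i _ do rewrite mulr_sumr.
  rewrite exchange_big /=; apply: eq_bigr => l _.
  rewrite -(sum_mul_delta _ _ (v 0) k) -(sum_mul_delta _ _ (v 0) l).
  rewrite -sumrB mulr_sumr mulr_suml; apply: eq_bigr => i _.
  by rewrite ![i == _]eq_sym; ring.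
- by move=> k l; rewrite -[x 0 l - x 0 k]opprB even_g''; ring.
- by rewrite !subrr mulr0.
Qed.


(** * The potential and its derivatives *)

(** The opposite of the second derivative of the pair potential, that is the
    weight of a pair of points in the Hessian of [V]. *)
Definition stiffness (R : realType) (x : R) : R := cos x + (2 - 2 * cos x)^-1.

Lemma potential_derivatives (R : realType) (x : R) : cos x != 1 ->
  let q z : R := 2 - 2 * cos z in
  is_derive x 1 (fun z => cos z + 2^-1 * ln (q z)) (- sin x + sin x / q x) /\
  is_derive x 1 (fun z => - sin z + sin z / q z) (- stiffness R x).
Proof.
move=> cx1 q.
have qx : 0 < q x by have := cos_le1 x; rewrite /q; lra.
have qx0 : q x != 0 by rewrite gt_eqF.
have Dq : is_derive x 1 q (2 * sin x).
  rewrite (_ : q = cst 2 - 2 *: (@cos R)); last by apply/funext => z.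
  by apply: is_derive_eq; rewrite /GRing.scale /=; ring.
split.
  rewrite (_ : (fun z => _) = (@cos R) + 2^-1 *: ((@ln R) \o q)); last first.
    by apply/funext => z.
  apply: is_derive_eq.
    apply: is_deriveD; apply: is_deriveZ; apply: is_derive1_comp.
    exact: is_derive1_ln.
  by rewrite /GRing.scale /=; field.
rewrite (_ : (fun z => _) = - (@sin R) + (@sin R) * (fun z => (q z)^-1)); last first.
  by apply/funext => z.
apply: is_derive_eq; rewrite /GRing.scale /= /stiffness -/(q x).
have -> : - cos x + (sin x * (- q x ^- 2 * (2 * sin x)) + (q x)^-1 * cos x) =
   - cos x + (q x * cos x - 2 * sin x ^+ 2) / q x ^+ 2 by field.
have -> : q x * cos x - 2 * sin x ^+ 2 = - q x by rewrite sin2cos2 /q; ring.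
by field.
Qed.

(** * Trigonometric sums over the vertices *)

Definition Ngon_angle (R : realType) (N m : nat) : R := 2 * pi * m%:R / N%:R.

Section NgonSums.

Context (R : realType) (n : nat).
Let N := n.+1.
Let angle (m : nat) : R := Ngon_angle R N m.

Lemma N_neq0 : N%:R != 0 :> R.
Proof. by rewrite pnatr_eq0. Qed.

Lemma Ngon_angleD a b : angle (a + b) = angle a + angle b.
Proof. by rewrite /angle /Ngon_angle natrD; ring. Qed.

Lemma Ngon_angle_full : angle N = pi *+ 2.
Proof. by rewrite /angle /Ngon_angle -mulr_natl; field; exact: N_neq0. Qed.

(** Seen from any vertex, the angles to the other vertices are the same modulo
    [2 pi]. The reindexing is [m -> s j - m] in the integers modulo [N]; the
    period of [F] absorbs the wrap-around when [s j < m]. *)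
Lemma sum_Ngon_difference (F : R -> R) (s : 'S_N) (j : 'I_N) :
  periodic F (pi *+ 2) ->
  \sum_(l < N) F (angle (s j) - angle (s l)) = \sum_(m < N) F (angle m).
Proof.
move=> perF.
transitivity (\sum_(l < N) F (angle (s j) - angle l)).
  by rewrite [RHS](reindex_perm s).
rewrite [RHS](reindex_inj (@subrI _ (s j))) /=; apply: eq_bigr => m _.
have lt_mN : (m < N)%N := ltn_ord m.
have lt_sN : (s j < N)%N := ltn_ord (s j).
rewrite modnDmr addnBA ?(ltnW lt_mN) //.
case: (leqP m (s j)) => [le_ms|lt_sm].
  rewrite -addnBAC // modnDr modn_small ?(leq_ltn_trans (leq_subr m _)) //.
  by congr F; apply/eqP; rewrite subr_eq -Ngon_angleD subnK.
rewrite modn_small; last by rewrite ltn_subLR ?ltn_add2r // ltnW // ltn_addl.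
rewrite -[LHS]perF -Ngon_angle_full; congr F; apply/eqP.
rewrite addrAC subr_eq -!Ngon_angleD subnK //.
by rewrite ltnW // ltn_addl.
Qed.

Lemma sum_Ngon_opp (F : R -> R) :
  periodic F (pi *+ 2) ->
  \sum_(m < N) F (- angle m) = \sum_(m < N) F (angle m).
Proof.
move=> perF; rewrite -(@sum_Ngon_difference F 1%g ord0) //.
apply: eq_bigr => m _; rewrite !perm1 /angle /Ngon_angle /=.
by congr F; ring.
Qed.

Lemma sum_odd_Ngon (F : R -> R) :
  periodic F (pi *+ 2) -> (forall x, F (- x) = - F x) ->
  \sum_(m < N) F (angle m) = 0.
Proof.
move=> perF oddF; have := sum_Ngon_opp F perF.
under eq_bigr do rewrite oddF.
by rewrite sumrN; lra.
Qed.

Lemma periodic_cos_mulrn k : periodic (fun x : R => cos (x *+ k)) (pi *+ 2).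
Proof. by move=> x; rewrite mulrnDl periodicn //; exact: cosD2pi. Qed.

Lemma periodic_sin_mulrn k : periodic (fun x : R => sin (x *+ k)) (pi *+ 2).
Proof. by move=> x; rewrite mulrnDl periodicn //; exact: sinD2pi. Qed.

Lemma Ngon_angle0 : angle 0 = 0.
Proof. by rewrite /angle /Ngon_angle mulr0 mul0r. Qed.

Lemma Ngon_angleMn m k : angle m *+ k = angle (m * k).
Proof. by rewrite /angle /Ngon_angle natrM -mulr_natr; ring. Qed.

Lemma cos_Ngon_angle_neq1 k : (0 < k < N)%N -> cos (angle k) != 1.
Proof.
move=> /andP[k0 kN].
have -> : angle k = (pi * k%:R / N%:R) *+ 2.
  by rewrite /angle /Ngon_angle -mulr_natl; ring.
rewrite cos_mulr2n cos2sin2.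
suff s0 : sin (pi * k%:R / N%:R) != 0 :> R.
  have : sin (pi * k%:R / N%:R) ^+ 2 != 0 :> R by rewrite expf_eq0.
  by apply: contra => /eqP E; apply/eqP; move: E; rewrite -mulr_natl; lra.
rewrite gt_eqF // sin_gt0_pi //; apply/andP; split.
  by rewrite !mulr_gt0 ?pi_gt0 ?invr_gt0 ?ltr0n.
by rewrite ltr_pdivrMr ?ltr0n // ltr_pM2l ?pi_gt0 // ltr_nat.
Qed.

(** Rotating by one vertex multiplies the vector of the cosine and sine sums by a
    rotation matrix; as the sine sum is zero, the cosine sum [C] satisfies
    [C = cos (2 pi k / N) * C], where the factor is not 1. *)
Lemma sum_cos_Ngon k : (0 < k < N)%N -> \sum_(m < N) cos (angle m *+ k) = 0.
Proof.
case/andP=> k0 kN; have N1 : (1 < N)%N by exact: leq_trans kN.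
set C := LHS; pose S := \sum_(m < N) sin (angle m *+ k).
have S0 : S = 0.
  apply: (sum_odd_Ngon (fun x => sin (x *+ k))); first exact: periodic_sin_mulrn.
  by move=> x; rewrite mulNrn sinN.
have shiftC : C = cos (angle k) * C + sin (angle k) * S.
  rewrite {1}/C -(@sum_Ngon_difference (fun x => cos (x *+ k)) 1%g (Ordinal N1));
    last exact: periodic_cos_mulrn.
  rewrite !mulr_sumr -big_split /=; apply: eq_bigr => m _.
  by rewrite !perm1 /= mulrnBl cosB (Ngon_angleMn 1) mul1n.
apply/eqP; move: shiftC; rewrite S0 mulr0 addr0 => /eqP.
rewrite -subr_eq0 -[X in X - _]mul1r -mulrBl mulf_eq0 subr_eq0 eq_sym.
by rewrite (negPf (cos_Ngon_angle_neq1 k _)) ?k0.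
Qed.

(** * The two eigenvalues *)

(** The [m = 0] summand is [stiffness 0 * 0 = 0], whatever the value given to the
    singular term of [stiffness 0]. *)
Definition Ngon_eigenvalue k : R :=
  \sum_(m < N) stiffness R (angle m) * (1 - cos (angle m *+ k)).

Lemma cos2x (x : R) : cos (x *+ 2) = 2 * cos x ^+ 2 - 1.
Proof. by rewrite cos_mulr2n mulr_natl. Qed.

Lemma chord_neq0 (m : 'I_N) : m != ord0 -> 2 - 2 * cos (angle m) != 0.
Proof.
move=> m0; have : cos (angle m) != 1.
  by apply: cos_Ngon_angle_neq1; rewrite lt0n m0 ltn_ord.
by apply: contra => /eqP ?; apply/eqP; lra.
Qed.

(** For [m <> 0] the summand is [cos a - cos a ^+ 2 + 1/2]. At [m = 0] this
    formula gives [1/2] instead of 0, hence the correction. *)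
Lemma Ngon_eigenvalue1 : (2 < N)%N -> Ngon_eigenvalue 1 = - 2^-1.
Proof.
move=> N2.
have -> : Ngon_eigenvalue 1 = \sum_(m < N)
   (cos (angle m *+ 1) - 2^-1 * cos (angle m *+ 2) - 2^-1 * (m == ord0)%:R).
  apply: eq_bigr => m _; rewrite mulr1n cos2x /stiffness.
  have [->|m0] := eqVneq m ord0.
    rewrite /= Ngon_angle0 cos0.
    by rewrite subrr mulr0; field.
  by rewrite /=; field; exact: chord_neq0.
rewrite !sumrB -!mulr_sumr !sum_cos_Ngon ?(ltnW N2) //.
rewrite (bigD1 ord0) //= big1 ?eqxx; last by move=> i /negPf ->.
by rewrite addr0 mulr0 mulr1 subr0 sub0r.
Qed.

(** Since [1 - cos (2 a) = 2 (1 - cos a) (1 + cos a)], the summand for [m <> 0] is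
    [cos a * (1 - cos (2 a)) + 1 + cos a]; at [m = 0] this formula gives 2 instead
    of 0. *)
Lemma Ngon_eigenvalue2 : (3 < N)%N -> Ngon_eigenvalue 2 = N%:R - 2.
Proof.
move=> N3.
have -> : Ngon_eigenvalue 2 = \sum_(m < N)
   (1 + 3 / 2 * cos (angle m *+ 1) - 2^-1 * cos (angle m *+ 3)
    - 2 * (m == ord0)%:R).
  apply: eq_bigr => m _; rewrite mulr1n /stiffness.
  have -> : cos (angle m *+ 3) = 4 * cos (angle m) ^+ 3 - 3 * cos (angle m).
    rewrite mulrSr cosD cos2x sin_mulr2n.
    rewrite -mulr_natl; have := sin2cos2 (angle m) => E.
    transitivity ((2 * cos (angle m) ^+ 2 - 1) * cos (angle m) -
      2 * cos (angle m) * sin (angle m) ^+ 2); first by ring.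
    by rewrite E; ring.
  rewrite cos2x.
  have [->|m0] := eqVneq m ord0.
    rewrite /= Ngon_angle0 cos0.
    have -> : 1 - (2 * 1 ^+ 2 - 1) = 0 :> R by ring.
    by rewrite mulr0; field.
  by rewrite /=; field; exact: chord_neq0.
rewrite !sumrB big_split /= -!mulr_sumr !sum_cos_Ngon ?(ltnW (ltnW N3)) //.
rewrite sumr_const card_ord.
rewrite [X in _ - 2 * X](bigD1 ord0) //= big1 ?eqxx; last by move=> i /negPf ->.
by rewrite addr0 !mulr0 mulr1 subr0 addr0.
Qed.

End NgonSums.


(** * Fourier modes of the Hessian at the N-gon *)

Lemma near_noncollision (R : realType) (N : nat) (x : 'rV[R]_N) :
  (forall k l : 'I_N, k != l -> cos (x 0 k - x 0 l) != 1) ->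
  \forall y \near x, forall k l : 'I_N, k != l ->
    cos ((y : 'rV[R]_N) 0 k - y 0 l) != 1.
Proof.
move=> x1.
pose apart (k l : 'I_N) (y : 'rV[R]_N) : Prop := k != l -> cos (y 0 k - y 0 l) != 1.
apply: (@filter_forall _ _ (fun k y => forall l, apart k l y) (nbhs x)) => k.
apply: (@filter_forall _ _ (apart k) (nbhs x)) => l; rewrite /apart.
have [->|kl] := eqVneq k l; first exact: nearW.
have : \forall y \near x, cos ((y : 'rV[R]_N) 0 k - y 0 l) - 1 != 0.
  pose q (y : 'rV[R]_N) : R := cos (y 0 k - y 0 l) - 1.
  apply: (@cvgr_neq0 _ _ _ (nbhs x) _ q (q x)); last by rewrite /q subr_eq0 x1.
  have cont_diff : {for x, continuous (fun y : 'rV[R]_N => y 0 k - y 0 l)}.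
    by apply: continuousB; exact: coord_continuous.
  apply: (@continuousB _ _ _ (fun y : 'rV[R]_N => cos (y 0 k - y 0 l)) (cst 1)).
    by apply: continuous_comp cont_diff _; exact: continuous_cos.
  exact: cst_continuous.
by apply: filterS => y; rewrite subr_eq0.
Qed.

Lemma Ngon_cos_neq1 (R : realType) (n : nat) (a b : 'I_n.+1) : a != b ->
  cos (Ngon_angle R n.+1 a - Ngon_angle R n.+1 b) != 1.
Proof.
wlog lt_ba : a b / (b < a)%N => [wlog_lt ab|_].
  move: (ab); rewrite -val_eqE neq_ltn => /orP[lt_ab|/wlog_lt]; last exact.
  by rewrite -opprB cosN wlog_lt // eq_sym.
rewrite -[X in Ngon_angle _ _ X - _](subnK (ltnW lt_ba)) Ngon_angleD addrK.
apply: cos_Ngon_angle_neq1.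
by rewrite subn_gt0 lt_ba (leq_ltn_trans (leq_subr _ _)).
Qed.

(** The row eigenvector is the [k]-th cosine mode of the angles measured from the
    rotation offset [c]; it is nonzero because the vertex at angle 0 contributes
    the entry 1. *)
Lemma eigenvalue_Hessian_Ngon (R : realType) (n : nat) (theta : 'rV[R]_n.+1)
    (k : nat) :
  is_Ngon theta -> eigenvalue (Hessian (@V R n.+1) theta) (Ngon_eigenvalue R n k).
Proof.
move=> [c [s theta_s]].
pose angle := Ngon_angle R n.+1.
have thetaE j : theta 0 j = c + angle (s j) by rewrite theta_s.
have diffE j l : theta 0 j - theta 0 l = angle (s j) - angle (s l).
  by rewrite !thetaE; ring.
have noncoll (j l : 'I_n.+1) : j != l -> cos (theta 0 j - theta 0 l) != 1.
  by move=> jl; rewrite diffE Ngon_cos_neq1 // (inj_eq perm_inj).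
apply/eigenvalueP; exists (\row_j cos (angle (s j) *+ k)); last first.
  apply/eqP => /rowP /(_ (s^-1 ord0)%g); rewrite !mxE permKV.
  by rewrite /angle /= Ngon_angle0 mul0rn cos0 => /eqP; rewrite oner_eq0.
apply/rowP => j.
rewrite (@mul_Hessian_pair_sum _ _ _ (fun z => - stiffness R z) theta); first last.
- apply: (@Hessian_pair_sum _ _ _ (fun z => cos z + 2^-1 * ln (2 - 2 * cos z))
    (fun z => - sin z + sin z / (2 - 2 * cos z))).
  + move=> y; congr (- _); apply: eq_bigr => a _; apply: eq_bigr => b _.
    by rewrite mulr1.
  + near=> y; move=> a b lt_ab /=.
    apply: (potential_derivatives _ _ _).1.
    have ab : a != b by rewrite -val_eqE neq_ltn lt_ab.
    by move: a b ab {lt_ab}; near: y; exact: near_noncollision.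
  + move=> a b lt_ab; apply: (potential_derivatives _ _ _).2.
    by rewrite noncoll // -val_eqE neq_ltn lt_ab.
- by move=> z; rewrite /stiffness cosN.
rewrite !mxE -sumrN.
pose E z := stiffness R z * (1 - cos (z *+ k)).
pose O z := stiffness R z * sin (z *+ k).
have periodic_stiffness : periodic (stiffness R) (pi *+ 2).
  by move=> z; rewrite /stiffness cosD2pi.
have perE : periodic E (pi *+ 2).
  by move=> z; rewrite /E periodic_stiffness (periodic_cos_mulrn R k z).
have perO : periodic O (pi *+ 2).
  by move=> z; rewrite /O periodic_stiffness (periodic_sin_mulrn R k z).
(* Even and odd parts of the sum in the angle difference [d]. *)
transitivity (cos (angle (s j) *+ k) * (\sum_l E (angle (s j) - angle (s l)))
   - sin (angle (s j) *+ k) * (\sum_l O (angle (s j) - angle (s l)))).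
  rewrite !mulr_sumr -sumrB; apply: eq_bigr => l _.
  rewrite !mxE diffE /E /O.
  set d := angle (s j) - angle (s l).
  have -> : angle (s l) *+ k = angle (s j) *+ k - d *+ k.
    by rewrite -mulrnBl /d; congr (_ *+ _); ring.
  by rewrite cosB; ring.
rewrite sum_Ngon_difference // sum_Ngon_difference // [X in _ - _ * X]sum_odd_Ngon //.
  by rewrite mulr0 subr0 mulrC.
by move=> z; rewrite /O /stiffness cosN mulNrn sinN mulrN.
Unshelve. all: by end_near.
Qed.

Theorem theorem3 (R : realType) (N : nat) (hN : (4 <= N)%N)
    (theta : 'rV[R]_N) (htheta : is_Ngon theta) :
  (exists a : R, 0 < a /\ eigenvalue (Hessian (@V R N) theta) a) /\
  (exists b : R, b < 0 /\ eigenvalue (Hessian (@V R N) theta) b).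
Proof.
case: N hN theta htheta => // n hN theta htheta; split.
  exists (Ngon_eigenvalue R n 2); split; last exact: eigenvalue_Hessian_Ngon.
  by rewrite Ngon_eigenvalue2 // subr_gt0 ltr_nat (leq_trans _ hN).
exists (Ngon_eigenvalue R n 1); split; last exact: eigenvalue_Hessian_Ngon.
by rewrite Ngon_eigenvalue1 ?(leq_trans _ hN) // oppr_lt0 invr_gt0.
Qed.
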